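(* Let $S$ be a finite nonempty set, let $1\le k<n$ be integers, and consider the nonhomogeneous $k$-th order multistate Markov parametrization $\phi$ on $S$ for paths of length $n$, together with a specified collection of forbidden transitions. Let $F\subseteq S^n$ be the set of paths involving at least one forbidden transition. Then the vanishing ideal of $\mathcal{V}_F$ is obtained from that of $\mathcal{V}$ by adding the polynomials $p_{i_1\ldots i_n}$ for all $(i_1,\ldots,i_n)\in F$: $$I(\mathcal{V}_F)=I(\mathcal{V})+\langle p_{i_1\ldots i_n}\mid (i_1,\ldots,i_n)\in F\rangle\subseteq\mathbb{R}[p_{i_1\ldots i_n}\mid (i_1,\dots,i_n)\in S^n].$$
   Context: Points of $\mathbb{R}^{S^k}\times\prod_{\ell=k+1}^n\mathbb{R}^{S^{k+1}}$ are written $(\pi,a)$ with coordinates $\pi_{i_1\ldots i_k}$ and $a^{(\ell)}_{i_{\ell-k}\cdots i_\ell}$ ($\ell=k+1,\dots,n$), all arbitrary real numbers. The map $\phi$ to $\mathbb{R}^{S^n}$ is $$\phi_{i_1\ldots i_n}(\pi,a)=\pi_{i_1\ldots i_k}\prod_{\ell=k+1}^n a^{(\ell)}_{i_{\ell-k}\cdots i_{\ell-1}i_\ell}.$$ A collection of forbidden transitions is a set $T$ of pairs $(\ell,(j_0,\dots,j_k))$ with $\ell\in\{k+1,\dots,n\}$ and $(j_0,\dots,j_k)\in S^{k+1}$; forbidding them means imposing $a^{(\ell)}_{j_0\cdots j_k}=0$ for every $(\ell,(j_0,\dots,j_k))\in T$. A path $(i_1,\dots,i_n)\in S^n$ involves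 a forbidden transition if $(\ell,(i_{\ell-k},\dots,i_\ell))\in T$ for some $\ell\in\{k+1,\dots,n\}$. $\mathcal{V}=\phi\bigl(\mathbb{R}^{S^k}\times\prod_{\ell=k+1}^n\mathbb{R}^{S^{k+1}}\bigr)$ is the image of the whole parameter space, and $\mathcal{V}_F$ is the image under $\phi$ of the set of those $(\pi,a)$ whose forbidden transition parameters are all zero (no nonnegativity or sum-to-one constraints are imposed). For $X\subseteq\mathbb{R}^{S^n}$, $I(X)$ is the ideal of all polynomials in $\mathbb{R}[p_{i_1\ldots i_n}\mid (i_1,\dots,i_n)\in S^n]$ vanishing at every point of $X$. *)

(* Defs.v *)
From mathcomp Require Import all_boot all_order all_algebra.
From mathcomp Require Import mpoly.
From mathcomp Require Import classical_sets reals.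

Set Implicit Arguments.
Unset Strict Implicit.
Unset Printing Implicit Defensive.

Import GRing.Theory.

Local Open Scope classical_set_scope.
Local Open Scope ring_scope.

Section Ideals.
Variable A : comNzRingType.

Definition is_ideal (I : set A) : Prop :=
  [/\ I 0,
      forall f g, I f -> I g -> I (f + g)
    & forall c f, I f -> I (c * f)].

Definition ideal_generated (G : set A) : set A := smallest is_ideal G.

Definition ideal_sum (I J : set A) : set A := [set g + h | g in I & h in J].

End Ideals.

(* The coordinate ring of the affine space of real functions on a finite type
   J has one indeterminate per element of J; multinomials numbers the
   indeterminates by ordinals, so they are matched to J by enum_rank. *)
Section CoordinateRing.
Variables (R : realType) (J : finType).

Local Notation coord_ring := {mpoly R[#|J|]}.

Definition coord_var (j : J) : coord_ring := 'X_(enum_rank j).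

Definition eval_at (x : J -> R) (f : coord_ring) : R :=
  f.@[fun m : 'I_#|J| => x (enum_val m)].

Definition vanishing_ideal (X : set (J -> R)) : set coord_ring :=
  [set f | forall x, X x -> eval_at x f = 0].

End CoordinateRing.

Arguments coord_var R {J} j.

Section Markov.
Variables (R : realType) (S : finType) (k n : nat).
Hypothesis k_lt_n : (k < n)%N.

(* Positions in a path are counted from 0, and l : 'I_(n - k) stands for the
   transition into the (l + k + 1)-st state i_(l+k+1), that is, for the index
   ell = l + k + 1 in {k+1, ..., n}. *)

Lemma window_pos_subproof (l : 'I_(n - k)) (j : 'I_k.+1) : (l + j < n)%N.
Proof.
have := ltn_ord l; rewrite ltn_subRL => lt_kl.
by apply: leq_ltn_trans lt_kl; rewrite addnC leq_add2r -ltnS.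
Qed.

Definition window_pos (l : 'I_(n - k)) (j : 'I_k.+1) : 'I_n :=
  Ordinal (window_pos_subproof l j).

(* (i_(ell-k), ..., i_ell) *)
Definition window (l : 'I_(n - k)) (i : n.-tuple S) : k.+1.-tuple S :=
  [tuple tnth i (window_pos l j) | j < k.+1].

(* (i_1, ..., i_k) *)
Definition initial (i : n.-tuple S) : k.-tuple S :=
  [tuple tnth i (widen_ord (ltnW k_lt_n) j) | j < k].

Definition params : Type :=
  ((k.-tuple S -> R) * ('I_(n - k) -> k.+1.-tuple S -> R))%type.

Definition phi (theta : params) (i : n.-tuple S) : R :=
  theta.1 (initial i) * \prod_(l < n - k) theta.2 l (window l i).

Definition transitions : finType := ('I_(n - k) * k.+1.-tuple S)%type.

Definition allowed_params (T : {set transitions}) : set params :=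
  [set theta : params | forall l j, (l, j) \in T -> theta.2 l j = 0].

Definition forbidden_paths (T : {set transitions}) : {set n.-tuple S} :=
  finset (fun i : n.-tuple S =>
            [exists l : 'I_(n - k), (l, window l i) \in T]).

Definition V : set (n.-tuple S -> R) := phi @` setT.

Definition V_F (T : {set transitions}) : set (n.-tuple S -> R) :=
  phi @` allowed_params T.

End Markov.

Arguments V R S {k n} k_lt_n.
Arguments V_F R {S k n} k_lt_n T.

(* Main.v *)
Require Import Defs.
From mathcomp Require Import all_boot all_order all_algebra.
From mathcomp Require Import mpoly.
From mathcomp Require Import boolp classical_sets reals.

(** Zeroing the forbidden transition parameters of theta zeroes the coordinates
    of phi(theta) on the forbidden paths F and leaves the others unchanged, so
    V_F is the image of V under the coordinate projection killing F.  Hence, for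
    f in I(V_F), the polynomial g obtained from f by setting p_i = 0 for i in F
    already vanishes on V, while f - g lies in the ideal of these p_i. *)

Local Open Scope classical_set_scope.

Import GRing.Theory.
Local Open Scope ring_scope.

Section Ideals.
Context {A : comNzRingType}.

Lemma ideal_generatedP (G : set A) : is_ideal (ideal_generated G).
Proof.
split=> [I [[]] //|f g If Ig I II|c f If I II].
- by case: (II) => -[_ ID _] _; apply: ID; [exact: If | exact: Ig].
- by case: (II) => -[_ _ IM] _; apply: IM; exact: If.
Qed.

Lemma mem_ideal_generated (G : set A) : G `<=` ideal_generated G.
Proof. exact: sub_smallest. Qed.

Lemma ideal_generated_sub (G I : set A) :
  is_ideal I -> G `<=` I -> ideal_generated G `<=` I.
Proof. exact: smallest_sub. Qed.

End Ideals.

Section CoordinateRing.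
Context {R : realType} {J : finType}.
Implicit Types (F : {set J}) (x : J -> R) (f g : {mpoly R[#|J|]}).

Lemma eval_at_coord_var x (j : J) : eval_at x (coord_var R j) = x j.
Proof. by rewrite /eval_at mevalXU enum_rankK. Qed.

Lemma vanishing_ideal_is_ideal (X : set (J -> R)) : is_ideal (vanishing_ideal X).
Proof.
split=> [x _|f g If Ig x Xx|c f If x Xx].
- by rewrite /eval_at meval0.
- by rewrite /eval_at mevalD -!/(eval_at _ _) If ?Ig ?addr0.
- by rewrite /eval_at mevalM -!/(eval_at _ _) If ?mulr0.
Qed.

Definition kill_coords F x : J -> R := fun j => if j \in F then 0 else x j.

(** The comorphism of the projection [kill_coords F]. Written as a substitution, it is a ring
    morphism, on which the induction below relies. *)
Definition kill_vars F f : {mpoly R[#|J|]} :=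
  f \mPo [tuple if enum_val m \in F then 0 else 'X_m | m < #|J|].

Lemma eval_at_kill_vars F x f :
  eval_at x (kill_vars F f) = eval_at (kill_coords F x) f.
Proof.
rewrite /eval_at comp_mpoly_meval; apply: mpoly.meval_eq => m.
by rewrite tnth_mktuple /kill_coords; case: ifP => _; rewrite ?meval0 ?mevalXU.
Qed.

(** Congruence modulo the ideal is stable under products and linear combinations, so it suffices to
    check variables: one outside [F] is fixed, one in [F] is itself a generator. *)
Lemma sub_kill_vars F f :
  ideal_generated [set coord_var R j | j in [set` F]] (f - kill_vars F f).
Proof.
set I := ideal_generated _; have [I0 ID IM] : is_ideal I := ideal_generatedP _.
pose P g := I (g - kill_vars F g).
have PM g h : P g -> P h -> P (g * h).
  move=> Pg Ph; rewrite /P /kill_vars rmorphM -!/(kill_vars _ _).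
  (* Replace one factor at a time, passing through [kill_vars F g * h]. *)
  have -> : g * h - kill_vars F g * kill_vars F h =
      h * (g - kill_vars F g) + kill_vars F g * (h - kill_vars F h).
    by rewrite !mulrBr addrA [h * kill_vars _ _]mulrC subrK mulrC.
  by apply: ID; apply: IM.
have P1 : P 1 by rewrite /P /kill_vars rmorph1 subrr.
have PX m : P 'X_m.
  rewrite /P /kill_vars comp_mpolyXU -tnth_nth tnth_mktuple.
  case: ifP => [Fm|_]; last by rewrite subrr.
  rewrite subr0; apply: mem_ideal_generated.
  by exists (enum_val m) => //; rewrite /coord_var enum_valK.
rewrite -/(P f); elim/mpolyind: f => [|c m f _ _ Pf].
  by rewrite /P /kill_vars raddf0 subrr.
rewrite /P /kill_vars linearP -!/(kill_vars _ _) opprD addrACA -scalerBr.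
(* The scalar is absorbed as a constant polynomial; the monomial is a product of powers of
   variables, covered by [P1], [PM] and [PX]. *)
apply: ID => //; rewrite -mul_mpolyC; apply: IM; rewrite -/(P _) mpolyXE_id.
apply: (big_ind P) => // i _; elim: (m i) => [|e IHe]; first by rewrite expr0.
by rewrite exprS; apply: PM.
Qed.

(** Stability of [X] under the projection makes every polynomial of I(X) vanish at the projected
    points, which places I(X) inside the left-hand ideal. *)
Lemma vanishing_ideal_kill_coords F (X : set (J -> R)) :
  [set kill_coords F x | x in X] `<=` X ->
  vanishing_ideal [set kill_coords F x | x in X] =
  ideal_sum (vanishing_ideal X)
            (ideal_generated [set coord_var R j | j in [set` F]]).
Proof.
move=> sub; apply/seteqP; split=> [f If|_ [g Ig [h Ih <-]]].
- exists (kill_vars F f).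
    by move=> x Xx; rewrite eval_at_kill_vars; apply: If; exists x.
  by exists (f - kill_vars F f); [exact: sub_kill_vars | rewrite addrC subrK].
- have [_ ID _] := vanishing_ideal_is_ideal [set kill_coords F x | x in X].
  apply: ID => [x /sub /Ig //|].
  apply: ideal_generated_sub Ih; first exact: vanishing_ideal_is_ideal.
  move=> _ [j Fj <-] _ [x _ <-].
  by rewrite eval_at_coord_var /kill_coords ifT.
Qed.

End CoordinateRing.

Section Markov.
Context {R : realType} {S : finType} {k n : nat} (k_lt_n : (k < n)%N).
Variable T : {set transitions S k n}.

Definition forbid (theta : params R S k n) : params R S k n :=
  (theta.1, fun l j => if (l, j) \in T then 0 else theta.2 l j).

Lemma allowed_forbid theta : allowed_params T (forbid theta).
Proof. by move=> l j Tlj; rewrite /= Tlj. Qed.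

Lemma forbid_allowed theta : allowed_params T theta -> forbid theta = theta.
Proof.
case: theta => p a Ta; congr pair.
apply/funext => l; apply/funext => j; case: ifP => // Tlj.
by rewrite -(Ta l j Tlj).
Qed.

(** On a path in F some factor of the product becomes zero; on any other path no factor is indexed
    by an element of [T], so none changes. *)
Lemma phi_forbid theta :
  phi k_lt_n (forbid theta) =
  kill_coords (forbidden_paths T) (phi k_lt_n theta).
Proof.
apply/funext => i; rewrite /kill_coords inE /phi /=.
case: existsP => [[l Tl]|nT]; first by rewrite (bigD1 l) //= Tl mul0r mulr0.
congr (_ * _); apply: eq_bigr => l _.
by case: ifP => // Tl; case: nT; exists l.
Qed.

(** An allowed [theta] is fixed by [forbid], so its image is its own projection; conversely
    [forbid theta] is an allowed preimage of the projection of the image of [theta]. *)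
Lemma V_F_kill_coords :
  V_F R k_lt_n T =
  [set kill_coords (forbidden_paths T) x | x in V R S k_lt_n].
Proof.
apply/seteqP; split=> [_ [theta Ttheta <-]|_ [_ [theta _ <-] <-]].
- exists (phi k_lt_n theta); first by exists theta.
  by rewrite -phi_forbid forbid_allowed.
- by exists (forbid theta); [exact: allowed_forbid | rewrite phi_forbid].
Qed.

Lemma V_F_sub_V : V_F R k_lt_n T `<=` V R S k_lt_n.
Proof. by move=> _ [theta _ <-]; exists theta. Qed.

End Markov.

Theorem corollary4p7 (R : realType) (S : finType) (k n : nat)
    (S_nonempty : (0 < #|S|)%N) (k_gt0 : (0 < k)%N) (k_lt_n : (k < n)%N)
    (T : {set transitions S k n}) :
  vanishing_ideal (V_F R k_lt_n T) =
  ideal_sum (vanishing_ideal (V R S k_lt_n))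
            (ideal_generated [set coord_var R i | i in [set` forbidden_paths T]]).
Proof.
rewrite V_F_kill_coords; apply: vanishing_ideal_kill_coords.
(* The projected set is [V_F] again, so stability of [V] only says that restricting the parameters
   shrinks the image. *)
by rewrite -V_F_kill_coords; apply: V_F_sub_V.
Qed.
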